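(* If $C$ is a nonempty compact max-plus convex subset of $E$, then $\mathsf{MPCC}_{\mathbf{u}}(C)$ is an absolute retract.
   Context: $E\neq\{0\}$ is an Archimedean Riesz space (real vector lattice; Archimedean means that if $ny\leqslant x$ for all $n\in\mathbb{N}$ then $y\leqslant 0$), and $\mathbf{u}\in E_+$ is a unit: for every $x\in E_+$ there is $n\in\mathbb{N}$ with $x\leqslant n\mathbf{u}$. The topology on $E$ is that of the metric $\mathsf{D}_{\mathbf{hu}}(x,y)=\max\{0,\mathbf{p}_{\mathbf{u}}(x-y)\}+\max\{0,\mathbf{p}_{\mathbf{u}}(y-x)\}$, where $\mathbf{p}_{\mathbf{u}}(x)=\inf\{t\in\mathbb{R}:x\leqslant t\mathbf{u}\}$. (It is equivalent to the metric of the norm $\|x\|_{\mathbf{u}}=\inf\{t\ge0:|x|\leqslant t\mathbf{u}\}$.) The max-plus convex hull of a nonempty $S\subset E$ is the set $[\![S]\!]$ of all elements $(x_1+t_1\mathbf{u})\vee\cdots\vee(x_m+t_m\mathbf{u})$ with $m\ge1$, $x_i\in S$, $t_i\in\mathbb{R}$ and $\max_i t_i=0$; $[\![\emptyset]\!]=\emptyset$. A set $C\subset E$ is max-plus convex if $C=[\![C]\!]$. $\mathsf{MPCC}_{\mathbf{u}}(C)$ is the family of nonempty compact max-plus convex subsets of $C$, with the topology of the Hausdorff metric associated to $\mathsf{D}_{\mathbf{hu}}$. An absolute retract is a metrizable space that is a retract of every metrizable space containing it as a closed subspace. *)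

(* Defs.v *)
From HB Require Import structures.
From mathcomp Require Import all_boot all_order all_algebra.
From mathcomp Require Import all_classical all_reals all_analysis.

Set Implicit Arguments.
Unset Strict Implicit.
Unset Printing Implicit Defensive.

Import Order.TTheory GRing.Theory Num.Theory.
Import numFieldNormedType.Exports.

Local Open Scope classical_set_scope.
Local Open Scope ring_scope.

(* The algebraic hierarchy admits no join of its lattice and Z-module         *)
(* structures below [realDomainType], which is totally ordered: the lattice   *)
(* operations are therefore introduced here, over the library's partial order.*)
HB.mixin Record isRiesz (R : realType) E
    & GRing.Lmodule R E & Num.POrderedZmodule E := {
  riesz_leD2r : forall z x y : E, x <= y -> x + z <= y + z;
  riesz_leZ : forall (a : R) (x y : E), 0 <= a -> x <= y -> a *: x <= a *: y;
  rjoin : E -> E -> E;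
  rmeet : E -> E -> E;
  rjoin_le : forall x y z : E, (rjoin x y <= z) = (x <= z) && (y <= z);
  le_rmeet : forall x y z : E, (z <= rmeet x y) = (z <= x) && (z <= y)
}.

#[short(type="rieszType")]
HB.structure Definition Riesz (R : realType) :=
  { E of GRing.Lmodule R E & Num.POrderedZmodule E & isRiesz R E }.

HB.mixin Record Riesz_isArchimedean (R : realType) E & Riesz R E := {
  riesz_archi : forall x y : E, (forall n : nat, y *+ n <= x) -> y <= 0
}.

#[short(type="archiRieszType")]
HB.structure Definition ArchiRiesz (R : realType) :=
  { E of Riesz R E & Riesz_isArchimedean R E }.

Record order_unit (R : realType) (E : archiRieszType R) := OrderUnit {
  order_unit_val :> E;
  order_unit_ge0 : 0 <= order_unit_val;
  order_unitP : forall x : E, 0 <= x -> exists n : nat, x <= order_unit_val *+ n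
}.

Section max_plus.
Context {R : realType} {E : archiRieszType R}.
Implicit Types (u x y : E) (S C : set E).

(* The seeds of the two iterated operators are among the terms being joined,  *)
(* so by idempotence they do not change the value.                            *)
Definition mp_hull u S : set E := [set z |
  exists (m : nat) (x : 'I_m.+1 -> E) (t : 'I_m.+1 -> R),
    [/\ forall i, S (x i),
        \big[Num.max/t ord0]_(i < m.+1) t i = 0 &
        z = \big[rjoin/x ord0 + t ord0 *: u]_(i < m.+1)
              (x i + t i *: u)]].

Definition mp_convex u C := C = mp_hull u C.

Definition pu u x : R := inf [set t : R | x <= t *: u].

Definition Dhu u x y : R :=
  Num.max 0 (pu u (x - y)) + Num.max 0 (pu u (y - x)).

End max_plus.
Arguments mp_hull {R E} u S : rename.
Arguments mp_convex {R E} u C : rename.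

Section Dhu_metric.
Context {R : realType} {E : archiRieszType R} (u : order_unit E).
Implicit Types (x y z : E) (s t : R).

Let leD x y z v : x <= y -> z <= v -> x + z <= y + v :> E.
Proof.
move=> xy zv; apply: (le_trans (riesz_leD2r z _ _ xy)).
by rewrite ![y + _]addrC; exact: riesz_leD2r.
Qed.

Let leB0 x y : (x - y <= 0) = (x <= y).
Proof.
apply/idP/idP => [/(riesz_leD2r y)|/(riesz_leD2r (- y))].
  by rewrite subrK add0r.
by rewrite subrr.
Qed.

Let leZu t s : t <= s -> t *: (u : E) <= s *: (u : E).
Proof.
move=> ts; rewrite -leB0 -scalerBl -opprB scaleNr -[- _]add0r leB0.
by rewrite -(scaler0 E (s - t)) riesz_leZ ?subr_ge0// order_unit_ge0.
Qed.

Let dominated x : exists n : nat, x <= n%:R *: (u : E).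
Proof.
have /andP[x_le ge0] : (x <= rjoin x 0) && (0 <= rjoin x 0) by rewrite -rjoin_le.
by have [n xn] := order_unitP u ge0; exists n; rewrite scaler_nat (le_trans x_le).
Qed.

Let unit0_trivial : (u : E) = 0 -> forall x, x = 0.
Proof.
move=> u0 x; apply/le_anti/andP; split.
  by have [n] := dominated x; rewrite u0 scaler0.
by have [n] := dominated (- x); rewrite u0 scaler0 -[- x]add0r leB0.
Qed.

Let pu_has_inf x : (u : E) != 0 -> has_inf [set t | x <= t *: (u : E)].
Proof.
move=> u0; split; first by have [n ?] := dominated x; exists n%:R.
have [m xm] := dominated (- x); exists (- m%:R) => t /= xt.
rewrite leNgt; apply/negP => tm; move/negP: u0; apply; apply/eqP/le_anti.
rewrite order_unit_ge0 andbT.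
have k0 : 0 < - (t + m%:R) by rewrite oppr_gt0 -ltrBrDr sub0r.
have := leD xt xm; rewrite subrr -scalerDl => tm0.
have k1 : 0 <= (- (t + m%:R))^-1 by rewrite invr_ge0 ltW.
have := riesz_leZ _ _ _ k1 tm0.
rewrite scaler0 scalerA invrN mulNr mulVf; last by rewrite -oppr_eq0 gt_eqF.
by rewrite scaleN1r => /(riesz_leD2r (u : E)); rewrite add0r addNr.
Qed.

Let le_pu x : (u : E) != 0 -> x <= pu u x *: (u : E).
Proof.
move=> u0; rewrite -leB0; apply: (@riesz_archi _ _ (u : E)) => -[|n].
  by rewrite mulr0n order_unit_ge0.
have n0 : 0 < n.+1%:R^-1 :> R by [].
have [t /= xt tp] := inf_adherent n0 (pu_has_inf x u0).
have : x - pu u x *: (u : E) <= n.+1%:R^-1 *: (u : E).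
  rewrite -[leRHS](addrK (pu u x *: (u : E))) riesz_leD2r//.
  by rewrite -scalerDl (le_trans xt)// leZu// addrC ltW.
move/(riesz_leZ _ _ _ (ler0n R n.+1)).
by rewrite scalerA mulfV ?scale1r// scaler_nat.
Qed.

Let pu_leP x s : (u : E) != 0 -> 0 <= s ->
  (Num.max 0 (pu u x) <= s) = (x <= s *: (u : E)).
Proof.
move=> u0 s0; rewrite ge_max s0 /=; apply/idP/idP => [ps|xs].
  by rewrite (le_trans (le_pu x u0))// leZu.
by apply: inf_lbound => //; case: (pu_has_inf x u0).
Qed.

Let max_ge0 t : 0 <= Num.max 0 t. Proof. by rewrite le_max lexx. Qed.

Lemma Dhu_xx x : Dhu u x x = 0.
Proof.
rewrite /Dhu subrr; have [u0|u0] := eqVneq (u : E) 0.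
  rewrite /pu inf_out ?maxxx ?addr0// => -[_ [b]] /(_ (b - 1)).
  by rewrite /= u0 scaler0 => /(_ (lexx _)); rewrite lerDl oppr_ge0 ler10.
suff -> : Num.max 0 (pu u (0 : E)) = 0 by rewrite addr0.
by apply/le_anti; rewrite max_ge0 andbT pu_leP// scale0r.
Qed.

Lemma Dhu_eq0 x y : Dhu u x y = 0 -> x = y.
Proof.
have [u0 _|u0 /eqP] := eqVneq (u : E) 0.
  by rewrite (unit0_trivial u0 x) (unit0_trivial u0 y).
rewrite paddr_eq0// ![Num.max _ _ == 0]eq_le !max_ge0 !andbT !pu_leP// !scale0r.
by rewrite !leB0 => /le_anti.
Qed.

Lemma Dhu_sym x y : Dhu u x y = Dhu u y x.
Proof. by rewrite /Dhu addrC. Qed.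

Lemma Dhu_triangle y x z : Dhu u x z <= Dhu u x y + Dhu u y z.
Proof.
have [u0|u0] := eqVneq (u : E) 0.
  rewrite (unit0_trivial u0 x) (unit0_trivial u0 y) (unit0_trivial u0 z).
  by rewrite Dhu_xx addr0.
have tri a b c : Num.max 0 (pu u (a - c)) <=
    Num.max 0 (pu u (a - b)) + Num.max 0 (pu u (b - c)).
  rewrite pu_leP ?addr_ge0// scalerDl.
  have -> : a - c = (a - b) + (b - c) by rewrite addrA subrK.
  by apply: leD; rewrite -pu_leP.
by rewrite addrACA [X in _ + X]addrC lerD// tri.
Qed.

End Dhu_metric.

Definition hu_space (R : realType) (E : archiRieszType R)
  (u : order_unit E) : Type := E.

HB.instance Definition _ (R : realType) (E : archiRieszType R)
  (u : order_unit E) := Choice.on (hu_space u).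

HB.instance Definition _ (R : realType) (E : archiRieszType R)
    (u : order_unit E) :=
  isMetric.Build R (hu_space u) (Dhu_xx u) (@Dhu_eq0 R E u) (Dhu_sym u)
    (Dhu_triangle u).

Definition compacts (R : realType) (M : metricType R) : set (set M) :=
  [set A | A !=set0 /\ compact A].

Definition hyperspace (R : realType) (M : metricType R) : Type :=
  @compacts R M.

HB.instance Definition _ (R : realType) (M : metricType R) :=
  Choice.on (hyperspace M).

Section hausdorff_metric.
Context {R : realType} {M : metricType R}.
Implicit Types (x y : M) (A B : set M).

Definition pt_dist x B : R := inf [set mdist x y | y in B].

Definition excess A B : R := sup [set pt_dist x B | x in A].

Definition hausdorff_dist (K L : hyperspace M) : R :=
  Num.max (excess (val K) (val L)) (excess (val L) (val K)).

Let pt_dist_lb x B : has_lbound [set mdist x y | y in B].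
Proof. by exists 0 => _ [y _ <-]; exact: mdist_ge0. Qed.

Let pt_dist_le x B y : B y -> pt_dist x B <= mdist x y.
Proof. by move=> By; apply: inf_lbound => //; exists y. Qed.

Let le_pt_dist x B t : B !=set0 -> (forall y, B y -> t <= mdist x y) ->
  t <= pt_dist x B.
Proof.
move=> [b Bb] tB; apply: lb_le_inf => [|_ [y By <-]]; last exact: tB.
by exists (mdist x b), b.
Qed.

Let compact_bound A x : compact A -> exists K, forall y, A y -> mdist x y <= K.
Proof.
move=> cA; have ctn : continuous (fun y => mdist x y : R^o).
  move=> y; apply/cvgrPdist_lt => e e0.
  apply/metricType_numDomainType.nbhs_mdistP; exists e => // z /= yze.
  rewrite ltr_distl ltrBlDr; apply/andP; split.
    by rewrite (le_lt_trans (metric_triangle x y z))// ltrD2l.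
  by rewrite (le_lt_trans (metric_triangle x z y))// ltrD2l metric_sym.
have : compact ((fun y => mdist x y : R^o) @` A).
  by apply: continuous_compact => //; exact: continuous_subspaceT.
move/compact_bounded => [K [_ AK]]; exists (K + 1) => y Ay.
have := AK (K + 1); rewrite ltrDl ltr01 => /(_ isT (mdist x y)) /=.
by rewrite ger0_norm ?mdist_ge0//; apply; exists y.
Qed.

Let pt_dist_excess A B x : compacts A -> compacts B -> A x ->
  pt_dist x B <= excess A B.
Proof.
move=> [_ cA] [[b Bb] _] Ax; apply: ub_le_sup; last by exists x.
have [K AK] := compact_bound b cA; exists K => _ [y Ay <-].
by rewrite (le_trans (pt_dist_le y Bb))// metric_sym AK.
Qed.

Let excess_le A B t : A !=set0 -> (forall x, A x -> pt_dist x B <= t) ->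
  excess A B <= t.
Proof.
move=> [a Aa] tA; apply: ge_sup => [|_ [x Ax <-]]; last exact: tA.
by exists (pt_dist a B), a.
Qed.

Let pt_dist_ge0 x B : B !=set0 -> 0 <= pt_dist x B.
Proof. by move=> B0; apply: le_pt_dist => // y _; exact: mdist_ge0. Qed.

Let excess_ge0 A B : compacts A -> compacts B -> 0 <= excess A B.
Proof.
move=> cA cB; have [[a Aa] _] := cA; have [B0 _] := cB.
exact: le_trans (pt_dist_ge0 a B0) (pt_dist_excess cA cB Aa).
Qed.

Let excess_xx A : compacts A -> excess A A = 0.
Proof.
move=> cA; apply/le_anti; rewrite excess_ge0// andbT; apply: excess_le => [|x Ax].
  by case: cA.
by rewrite -(mdistxx x) pt_dist_le.
Qed.

Let excess_eq0 A B : compacts A -> compacts B -> excess A B = 0 -> A `<=` B.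
Proof.
move=> cA cB AB0 x Ax; have [B0 Bc] := cB.
have : closed B by apply: compact_closed Bc; exact: metric_hausdorff.
apply=> N /metricType_numDomainType.nbhs_mdistP[e /= e0 eN].
have : pt_dist x B < e.
  by rewrite (le_lt_trans _ e0)// -AB0 pt_dist_excess.
case/inf_lt => [|_ [y By <-] xye]; last by exists y; split=> //; exact: eN.
by case: B0 => b Bb; exists (mdist x b), b.
Qed.

Let excess_triangle B A C : compacts A -> compacts B -> compacts C ->
  excess A C <= excess A B + excess B C.
Proof.
move=> cA cB cC; have [A0 _] := cA; have [B0 _] := cB; have [C0 _] := cC.
apply: excess_le => // x Ax.
rewrite (le_trans _ (lerD (pt_dist_excess cA cB Ax) (lexx _)))//.
rewrite -lerBlDr; apply: le_pt_dist => // y By.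
rewrite lerBlDr (le_trans _ (lerD (lexx _) (pt_dist_excess cB cC By)))//.
rewrite -lerBlDl; apply: le_pt_dist => // z Cz.
by rewrite lerBlDl (le_trans (pt_dist_le x Cz))// metric_triangle.
Qed.

Let cpt (K : hyperspace M) : compacts (val K).
Proof. exact: set_valP. Qed.

Lemma hausdorff_distxx K : hausdorff_dist K K = 0.
Proof. by rewrite /hausdorff_dist maxxx excess_xx//; exact: cpt. Qed.

Lemma hausdorff_dist_eq0 K L : hausdorff_dist K L = 0 -> K = L.
Proof.
have [cK cL] := (cpt K, cpt L); move=> KL0; apply: val_inj.
have /andP[KL LK] : (excess (val K) (val L) <= 0) && (excess (val L) (val K) <= 0).
  by rewrite -ge_max -KL0.
by apply/seteqP; split; apply: excess_eq0 => //; apply/le_anti;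
  rewrite excess_ge0// andbT.
Qed.

Lemma hausdorff_dist_sym K L : hausdorff_dist K L = hausdorff_dist L K.
Proof. by rewrite /hausdorff_dist maxC. Qed.

Lemma hausdorff_dist_triangle L K N : 
  hausdorff_dist K N <= hausdorff_dist K L + hausdorff_dist L N.
Proof.
have [[cK cL] cN] := (cpt K, cpt L, cpt N).
rewrite /hausdorff_dist ge_max; apply/andP; split.
  rewrite (le_trans (excess_triangle cK cL cN))//.
  by rewrite lerD// le_max lexx.
rewrite (le_trans (excess_triangle cN cL cK))// addrC.
by rewrite lerD// le_max lexx orbT.
Qed.

HB.instance Definition _ := isMetric.Build R (hyperspace M)
  hausdorff_distxx hausdorff_dist_eq0 hausdorff_dist_sym hausdorff_dist_triangle.

End hausdorff_metric.

Definition MPCC (R : realType) (E : archiRieszType R) (u : order_unit E)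
    (C : set E) : set (hyperspace (hu_space u)) :=
  [set K | mp_convex (u : E) (val K : set E) /\ (val K : set E) `<=` C].

Arguments MPCC {R E} u C : rename.

Definition metrizable (R : realType) (T : topologicalType) : Prop :=
  exists d : T -> T -> R,
    [/\ forall x, d x x = 0,
        forall x y, d x y = 0 -> x = y,
        forall x y, d x y = d y x,
        forall x y z, d x z <= d x y + d y z &
        forall x, nbhs x = nbhs_ball_ (fun y e => [set z | d y z < e]) x].

(* A copy of T as a closed subspace of Y; the last clause says that T carries *)
(* the topology induced by i.                                                 *)
Definition closed_embedding (T Y : topologicalType) (i : T -> Y) : Prop :=
  [/\ injective i, closed (range i) &
      forall U : set T, open U <-> exists2 V : set Y, open V & i @^-1` V = U].

Definition absolute_retract (R : realType) (T : topologicalType) : Prop :=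
  metrizable R T /\
  forall (Y : topologicalType) (i : T -> Y),
    metrizable R Y -> closed_embedding i ->
    exists2 r : Y -> T, continuous r & cancel i r.

(* Main.v *)
Require Import Defs.
From HB Require Import structures.
From mathcomp Require Import all_boot all_order all_algebra.
From mathcomp Require Import all_classical all_reals all_analysis.
From mathcomp Require Import ring lra.

Set Implicit Arguments.
Unset Strict Implicit.
Unset Printing Implicit Defensive.

Import Order.TTheory GRing.Theory Num.Theory.
Import numFieldNormedType.Exports.
Local Open Scope classical_set_scope.
Local Open Scope ring_scope.

(** Let X be the space of compact max-plus convex subsets of C, embedded as a
    closed subspace of a metric space Y with distance d. A Dugundji-type
    extension of the identity of X gives the retraction, but in max-plus
    geometry no partition of unity is needed, because suprema of arbitrary
    families replace locally finite sums. To a point y outside X and a member K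
    of X attach the weight

      s_y(K) = - D * max(0, h_y(K) / g_y - 2),

    where h_y(K) = min(1, d(y, K)), g_y is the infimum of h_y, and D bounds the
    spread of C: x - D u <= x' for all x, x' in C. Then r(y) is the closure of
    the set of all suprema of x_K + s_y(K) u, one point x_K being chosen in each
    K ([wjoin], [mpcc_join]).

    - These suprema exist although E need not be complete: the weights are
      nonpositive and one of them is zero, so up to joins with the unlowered
      term everything takes place in C, and a compact set closed under joins
      contains the suprema of its nonempty subsets ([compact_sup],
      [weighted_lub]).
    - The set of these suprema is max-plus convex because joins commute with
      suprema and translations ([wjoin_convex]), and convexity survives closure.
    - A uniformly small change of the weights moves every supremum by little
      ([wjoin_weights]); since h_y is bounded by 1, the weights are continuous
      in y uniformly in K ([weight_lipschitz]). So r is continuous off X.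
    - Let y tend to a point K0 of X. A set K with s_y(K) > - D satisfies
      h_y(K) < 3 g_y, hence is close to K0, while a term of weight at most - D
      lies below the term of weight zero and does not contribute. Convexity of
      K0 then makes r(y) close to K0 ([wjoin_near]). So r is continuous at
      the points of X. *)

(** * Order in a Riesz space with a unit *)

Section riesz_order.
Context {R : realType} {E : archiRieszType R} (u : order_unit E).
Implicit Types (x y z b : E) (s t e : R).

Lemma riesz_leBrDr x y z : (x <= y - z) = (x + z <= y).
Proof.
apply/idP/idP => [/(riesz_leD2r z)|/(riesz_leD2r (- z))]; last by rewrite addrK.
by rewrite subrK.
Qed.

Lemma riesz_leBlDr x y z : (x - z <= y) = (x <= y + z).
Proof. by rewrite -{2}[z]opprK riesz_leBrDr. Qed.

Lemma riesz_leD x y z b : x <= y -> z <= b -> x + z <= y + b.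
Proof.
move=> xy zb; apply: le_trans (riesz_leD2r z _ _ xy) _.
by rewrite ![y + _]addrC; exact: riesz_leD2r.
Qed.

Lemma scale_unit_le t s : t <= s -> t *: (u : E) <= s *: (u : E).
Proof.
rewrite -subr_ge0 => st; have := riesz_leZ _ _ _ st (order_unit_ge0 u).
by rewrite scaler0 scalerBl riesz_leBrDr add0r.
Qed.

Lemma le_addu x t s : t <= s -> x + t *: (u : E) <= x + s *: (u : E).
Proof. by move=> ts; apply: riesz_leD => //; exact: scale_unit_le. Qed.

Lemma addu_le x t : t <= 0 -> x + t *: (u : E) <= x.
Proof. by move=> /(le_addu x); rewrite scale0r addr0. Qed.

Lemma addu_ge x t : 0 <= t -> x <= x + t *: (u : E).
Proof. by move=> /(le_addu x); rewrite scale0r addr0. Qed.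

Lemma unit_dominates x : exists2 t, 0 <= t & x <= t *: (u : E).
Proof.
have /andP[x_le ge0] : (x <= rjoin x 0) && (0 <= rjoin x 0) by rewrite -rjoin_le.
have [n xn] := order_unitP u ge0; exists n%:R => //.
by rewrite scaler_nat (le_trans x_le).
Qed.

Lemma le_rjoinl x y : x <= rjoin x y.
Proof. by have /andP[] : (x <= rjoin x y) && (y <= rjoin x y) by rewrite -rjoin_le. Qed.

Lemma le_rjoinr x y : y <= rjoin x y.
Proof. by have /andP[] : (x <= rjoin x y) && (y <= rjoin x y) by rewrite -rjoin_le. Qed.

Lemma eq_of_ub x y : (forall b, x <= b <-> y <= b) -> x = y.
Proof. by move=> xy; apply/le_anti/andP; split; apply/xy. Qed.

Lemma rjoinC x y : rjoin x y = rjoin y x.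
Proof. by apply: eq_of_ub => b; rewrite !rjoin_le andbC. Qed.

Lemma rjoinxx x : rjoin x x = x.
Proof. by apply: eq_of_ub => b; rewrite rjoin_le andbb. Qed.

(** This is where the Archimedean property enters. *)
Lemma le_addu_limit x y : (forall e, 0 < e -> x <= y + e *: (u : E)) -> x <= y.
Proof.
move=> xy; have xy0 : x - y <= 0.
  apply: (@riesz_archi _ _ (u : E)) => -[|n].
    by rewrite mulr0n order_unit_ge0.
  have n0 : 0 < n.+1%:R^-1 :> R by [].
  have : x - y <= n.+1%:R^-1 *: (u : E).
    by rewrite riesz_leBlDr addrC; exact: xy.
  move/(riesz_leZ _ _ _ (ler0n R n.+1)).
  by rewrite scalerA mulfV ?scale1r// scaler_nat.
by move: xy0; rewrite riesz_leBlDr add0r.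
Qed.

End riesz_order.

(** * Approximation up to a multiple of the unit *)

Section approximation.
Context {R : realType} {E : archiRieszType R} (u : order_unit E).
Implicit Types (x y z b : E) (s t e : R).

Definition approx e x y : Prop :=
  x <= y + e *: (u : E) /\ y <= x + e *: (u : E).

Lemma approx_sym e x y : approx e x y -> approx e y x.
Proof. by case. Qed.

Lemma approxxx e x : 0 <= e -> approx e x x.
Proof. by move=> e0; split; exact: addu_ge. Qed.

Lemma approx_le e1 e2 x y : e1 <= e2 -> approx e1 x y -> approx e2 x y.
Proof.
by move=> e12 [xy yx]; split; [apply: le_trans xy _|apply: le_trans yx _];
  exact: le_addu.
Qed.

Lemma approx_bounded x y : exists e, approx e x y.
Proof.
have [s s0 xy] := unit_dominates u (x - y).
have [t t0 yx] := unit_dominates u (y - x).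
exists (s + t); split; rewrite addrC -riesz_leBlDr.
  by apply: le_trans xy (scale_unit_le _ _); rewrite lerDl.
by apply: le_trans yx (scale_unit_le _ _); rewrite lerDr.
Qed.

Lemma approx_trans e1 e2 y x z :
  approx e1 x y -> approx e2 y z -> approx (e1 + e2) x z.
Proof.
move=> [xy yx] [yz zy]; split; rewrite scalerDl.
  by rewrite [_ *: _ + _]addrC addrA (le_trans xy)// riesz_leD2r.
by rewrite addrA (le_trans zy)// riesz_leD2r.
Qed.

Lemma approx_rjoin e t x y x' y' : approx e x x' -> approx e y y' ->
  approx e (rjoin x (y + t *: (u : E))) (rjoin x' (y' + t *: (u : E))).
Proof.
have half a b a' b' : a <= a' + e *: (u : E) -> b <= b' + e *: (u : E) ->
    rjoin a (b + t *: (u : E)) <= rjoin a' (b' + t *: (u : E)) + e *: (u : E).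
  move=> aa bb; rewrite rjoin_le; apply/andP; split.
    by apply: le_trans aa _; rewrite riesz_leD2r// le_rjoinl.
  apply: (@le_trans _ _ (b' + t *: (u : E) + e *: (u : E))).
    by rewrite addrAC riesz_leD2r.
  by rewrite riesz_leD2r// le_rjoinr.
by move=> [xx' x'x] [yy' y'y]; split; exact: half.
Qed.

(** Whether or not the infimum [pu] is attained or even finite, a bound on it
    is a bound in the order. *)
Lemma pu_lt_le x e : pu u x < e -> x <= e *: (u : E).
Proof.
move=> xe; have : exists2 t, x <= t *: (u : E) & t <= e.
  have [lb|] := pselect (has_lbound [set t | x <= t *: (u : E)]).
    have [|t xt te] := inf_lt _ xe; last by exists t => //; exact: ltW.
      have [t _ xt] := unit_dominates u x; by exists t.
  move=> nlb; apply: contrapT => H; apply: nlb; exists e => t /= xt.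
  by rewrite leNgt; apply/negP => /ltW te; apply: H; exists t.
by move=> [t xt te]; apply: le_trans xt (scale_unit_le _ te).
Qed.

Lemma pu_le x e : 0 <= e -> x <= e *: (u : E) -> pu u x <= e.
Proof.
move=> e0 xe; have [lb|nlb] := pselect (has_lbound [set t | x <= t *: (u : E)]).
  exact: ge_inf.
by rewrite /pu inf_out// => -[].
Qed.

Lemma Dhu_lt_approx x y e : Dhu u x y < e -> approx e x y.
Proof.
have max0 (a : R) : 0 <= Num.max 0 a by rewrite le_max lexx.
have half z t : Num.max 0 (pu u z) + Num.max 0 t < e -> z <= e *: (u : E).
  move=> zt; apply: pu_lt_le; apply: le_lt_trans zt.
  by rewrite -[X in X <= _]addr0 lerD// le_max lexx orbT.
move=> xye; split; rewrite addrC -riesz_leBlDr.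
  exact: half xye.
by rewrite /Dhu addrC in xye; exact: half xye.
Qed.

Lemma approx_Dhu x y e : 0 <= e -> approx e x y -> Dhu u x y <= e + e.
Proof.
move=> e0 [xy yx]; apply: lerD; rewrite ge_max e0/= pu_le//.
  by rewrite riesz_leBlDr addrC.
by rewrite riesz_leBlDr addrC.
Qed.

End approximation.

(** * The topology of the unit *)

Section topology.
Context {R : realType} {E : archiRieszType R} (u : order_unit E).
Implicit Types (x y z b : E) (t e : R).

Lemma nbhs_approx (x : hu_space u) e : 0 < e ->
  nbhs x [set y : hu_space u | approx u e x y].
Proof.
move=> e0; apply/metricType_numDomainType.nbhs_mdistP; exists e => // y /=.
exact: Dhu_lt_approx.
Qed.

Lemma closure_approx (A : set (hu_space u)) (x : hu_space u) :
  closure A x <-> forall e, 0 < e -> exists2 y, A y & approx u e x y.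
Proof.
split=> [clA e e0|apxA B /metricType_numDomainType.nbhs_mdistP[e /= e0 eB]].
  by have [y [Ay xy]] := clA _ (nbhs_approx x e0); exists y.
have e4 : 0 < e / 4 by rewrite divr_gt0.
have [y Ay xy] := apxA _ e4; exists y; split=> //; apply: eB => /=.
by apply: le_lt_trans (approx_Dhu (ltW e4) xy) _; lra.
Qed.

(** Bounded differences: since the unit dominates every element, the balls
    around [0] are an increasing cover of a compact set. *)
Lemma compact_spread (K : set (hu_space u)) : compact K ->
  exists2 D, 0 < D & forall x y, K x -> K y -> x + (- D) *: (u : E) <= y.
Proof.
move=> /compact_near_coveringP cK.
have : \forall t \near +oo, K `<=` [set x : hu_space u | approx u t (0 : E) x].
  apply: cK => x _; have [a ax] := approx_bounded u 0 x.
  exists ([set y : hu_space u | approx u 1 x y], [set t | a + 1 <= t]).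
    by split; [exact: nbhs_approx|exact: nbhs_pinfty_ge (num_real _)].
  by move=> [y t] /= [xy at1]; apply: approx_le at1 _; exact: approx_trans ax xy.
move=> /(filterI (nbhs_pinfty_gt (num_real 0)))/filter_ex[t [t0 Kt]].
exists (t + t); first by rewrite addr_gt0.
move=> x y /Kt /approx_sym Kx /Kt Ky; have [xy _] := approx_trans Kx Ky.
by rewrite scaleNr riesz_leBlDr.
Qed.

(** A compact set closed under joins contains suprema: the members below every
    upper bound of [S] are directed by the order, and a cluster point of this
    net is its supremum. *)
Lemma compact_sup (K S : set (hu_space u)) : compact K ->
  (forall x y, K x -> K y -> K (rjoin (x : E) y)) -> S `<=` K -> S !=set0 ->
  exists2 c, K c & forall b, (c : E) <= b <-> forall s, S s -> (s : E) <= b.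
Proof.
move=> cK Kjoin SK [s0 Ss0].
pose J := [set z : hu_space u | K z /\
  forall b, (forall s, S s -> (s : E) <= b) -> (z : E) <= b].
have SJ : S `<=` J by move=> s Ss; split=> [|b]; [exact: SK|exact].
pose up (j : hu_space u) := [set z : hu_space u | J z /\ (j : E) <= z].
have PF : ProperFilter (filter_from J up).
  apply: filter_from_proper => [|j Jj]; last by exists j; split.
  apply: filter_from_filter => [|i j [Ki iS] [Kj jS]]; first by exists s0; exact: SJ.
  exists (rjoin (i : E) j).
    by split=> [|b bS]; [exact: Kjoin|rewrite rjoin_le iS ?jS].
  by move=> z [Jz]; rewrite rjoin_le => /andP[iz jz].
have [|c [Kc cl]] := cK (filter_from J up).
  by exists s0; [exact: SJ|move=> z [[]]].
exists c => // b; split=> [cb s Ss|bS].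
  apply: le_trans cb; apply: (le_addu_limit (u := u)) => e e0.
  have [|z [[_ sz] [_ zc]]] := cl (up s) _ _ (nbhs_approx c e0).
    by exists s => //; exact: SJ.
  exact: le_trans sz zc.
apply: (le_addu_limit (u := u)) => e e0.
have [|z [[[_ zS] _] [cz _]]] := cl (up s0) _ _ (nbhs_approx c e0).
  by exists s0 => //; exact: SJ.
by apply: le_trans cz _; apply: riesz_leD2r; exact: zS.
Qed.

End topology.

(** * Max-plus convexity *)

Section convexity.
Context {R : realType} {E : archiRieszType R} (u : order_unit E).
Implicit Types (x y z b : E) (s t e : R) (K C : set E).

Lemma bigjoin_le (I : finType) x0 (f : I -> E) b :
  \big[rjoin/x0]_i f i <= b <-> x0 <= b /\ forall i, f i <= b.
Proof.
split=> [|[x0b fb]]; last first.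
  by elim/big_ind: _ => // x y xb yb; rewrite rjoin_le xb.
suff H (r : seq I) : \big[rjoin/x0]_(i <- r) f i <= b ->
    x0 <= b /\ forall i, i \in r -> f i <= b.
  by move=> /H[x0b fb]; split=> // i; apply: fb; rewrite mem_index_enum.
elim: r => [|i r IH]; first by rewrite big_nil.
rewrite big_cons rjoin_le => /andP[ib /IH[x0b rb]]; split=> // j.
by rewrite inE => /predU1P[->//|]; exact: rb.
Qed.

(** Since the largest weight is zero, a combination of several points can be
    built by joining lowered points one by one to one of the unlowered points. *)
Lemma mp_convexP C : mp_convex (u : E) C <->
  forall x y t, t <= 0 -> C x -> C y -> C (rjoin x (y + t *: (u : E))).
Proof.
split=> [Cu x y t t0 Cx Cy|C2].
  rewrite Cu.
  (* The combination is a hull of two points with weights 0 and t. *)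
  pose f (i : 'I_2) := if i == ord0 then x else y.
  pose g (i : 'I_2) := if i == ord0 then 0 else t.
  exists 1, f, g; split=> [i||].
  - by rewrite /f; case: ifP.
  - by rewrite !big_ord_recl big_ord0 /g /= (max_r t0) maxxx.
  - apply: eq_of_ub => b; rewrite bigjoin_le rjoin_le; split=> [/andP[xb yb]|].
      rewrite {1}/f {1}/g eqxx scale0r addr0; split=> // i.
      by rewrite /f /g; case: ifP; rewrite ?scale0r ?addr0.
    move=> [xb fb]; have := fb ord_max; move: xb.
    by rewrite /f /g eqxx scale0r addr0 => ->.
apply/seteqP; split=> [x Cx|z [m [x [t [Cx t0 ->]]]]].
  exists 0, (fun=> x), (fun=> 0); split=> //.
    by rewrite big_ord_recl big_ord0 maxxx.
  by rewrite big_ord_recl big_ord0 rjoinxx scale0r addr0.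
have t_le0 i : t i <= 0 by rewrite -t0; exact: le_bigmax.
have [k tk] : exists k, t k = 0.
  rewrite -t0; elim/big_rec: _ => [|i _ _ [k <-]]; first by exists ord0.
  by case: (leP (t i) (t k)) => _; [exists k|exists i].
have -> : \big[rjoin/x ord0 + t ord0 *: (u : E)]_i (x i + t i *: (u : E)) =
    \big[rjoin/x k]_i (x i + t i *: (u : E)).
  apply: eq_of_ub => b; rewrite !bigjoin_le; split=> -[_ xb]; split=> //.
  by have := xb k; rewrite tk scale0r addr0.
by elim/big_rec: _ => [//|i y _ Cy]; rewrite rjoinC; exact: C2.
Qed.

End convexity.

(** * Weighted joins of families of sets *)

Section weighted_join.
Context {R : realType} {E : archiRieszType R} (u : order_unit E) (I : Type).
Implicit Types (x y z b c : E) (t e : R) (C : set E) (f : I -> E).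
Implicit Types (K : I -> set E) (s : I -> R).

(** The equivalence with all upper bounds makes a least upper bound stable under
    every transformation of inequalities, with no completeness assumed. *)
Definition lub_of f c : Prop := forall b, c <= b <-> forall i, f i <= b.

Lemma lub_of_le f g c d e : lub_of f c -> lub_of g d ->
  (forall i, f i <= g i + e *: (u : E)) -> c <= d + e *: (u : E).
Proof.
move=> fc gd fg; apply/fc => i; apply: le_trans (fg i) _.
by apply: riesz_leD2r; move: i; apply/gd.
Qed.

Lemma approx_lub f g c d e : lub_of f c -> lub_of g d ->
  (forall i, approx u e (f i) (g i)) -> approx u e c d.
Proof.
by move=> fc gd fg; split; [apply: lub_of_le fc gd _|apply: lub_of_le gd fc _];
  move=> i; case: (fg i).
Qed.

(** The terms themselves need not lie in [C]; their joins with the term of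
    weight zero do, and have the same upper bounds. *)
Lemma weighted_lub C f s i0 : compact (C : set (hu_space u)) ->
  mp_convex (u : E) C -> (forall i, C (f i)) -> (forall i, s i <= 0) ->
  s i0 = 0 -> exists2 c, C c & lub_of (fun i => f i + s i *: (u : E)) c.
Proof.
move=> cC /mp_convexP C2 Cf s_le0 si0.
pose g i := rjoin (f i0) (f i + s i *: (u : E)).
have [x y Cx Cy|_ [i _ <-]||c Cc cg] := @compact_sup _ _ u C (range g) cC.
- by have := C2 x y 0 (lexx _) Cx Cy; rewrite scale0r addr0.
- exact: C2.
- by exists (g i0), i0.
exists c => // b; rewrite cg; split=> [gb i|fb _ [i _ <-]].
  by have := gb (g i); rewrite rjoin_le => /(_ (imageT _ _))/andP[].
by rewrite rjoin_le fb andbT; have := fb i0; rewrite si0 scale0r addr0.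
Qed.

(** The max-plus analogue of a weighted Minkowski sum: one point is taken from
    each set, and all the sets contribute to each supremum. Combinations that
    may omit some of the sets would not depend continuously on the weights. *)
Definition wjoin K s : set E := [set z | exists2 f,
  forall i, K i (f i) & lub_of (fun i => f i + s i *: (u : E)) z].

Lemma wjoin_sub C K s i0 : compact (C : set (hu_space u)) ->
  mp_convex (u : E) C -> (forall i, K i `<=` C) -> (forall i, s i <= 0) ->
  s i0 = 0 -> wjoin K s `<=` C.
Proof.
move=> cC C2 KC s_le0 si0 z [f Kf zf].
have [c Cc cf] := weighted_lub cC C2 (fun i => KC _ _ (Kf i)) s_le0 si0.
by have -> : z = c by apply: eq_of_ub => b; rewrite zf cf.
Qed.

Lemma wjoin_neq0 C K s i0 : compact (C : set (hu_space u)) ->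
  mp_convex (u : E) C -> (forall i, K i `<=` C) -> (forall i, K i !=set0) ->
  (forall i, s i <= 0) -> s i0 = 0 -> wjoin K s !=set0.
Proof.
move=> cC C2 KC /choice[f Kf] s_le0 si0.
have [c _ cf] := weighted_lub cC C2 (fun i => KC _ _ (Kf i)) s_le0 si0.
by exists c, f.
Qed.

Lemma wjoin_convex K s : (forall i, mp_convex (u : E) (K i)) ->
  mp_convex (u : E) (wjoin K s).
Proof.
move=> K2; apply/mp_convexP => x y t t0 [f Kf xf] [g Kg yg].
exists (fun i => rjoin (f i) (g i + t *: (u : E))).
  by move=> i; have /mp_convexP := K2 i; exact.
move=> b.
have key i : (rjoin (f i) (g i + t *: (u : E)) + s i *: (u : E) <= b) =
    (f i + s i *: (u : E) <= b) && (g i + s i *: (u : E) <= b - t *: (u : E)).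
  by rewrite -[LHS]riesz_leBrDr rjoin_le !riesz_leBrDr [in RHS]addrAC.
rewrite rjoin_le -riesz_leBrDr; split=> [/andP[/xf fb /yg gb] i|fgb].
  by rewrite key fb gb.
by apply/andP; split; [apply/xf|apply/yg] => i; have := fgb i; rewrite key => /andP[].
Qed.

Definition set_approx e (A B : set E) : Prop :=
  (forall x, A x -> exists2 y, B y & approx u e x y) /\
  (forall y, B y -> exists2 x, A x & approx u e x y).

(** Keep the chosen points and change only the weights: the two suprema differ
    by no more than the weights do. *)
Lemma wjoin_weights C K s s' i0 i1 e : compact (C : set (hu_space u)) ->
  mp_convex (u : E) C -> (forall i, K i `<=` C) ->
  (forall i, s i <= 0) -> s i0 = 0 -> (forall i, s' i <= 0) -> s' i1 = 0 ->
  (forall i, `|s i - s' i| <= e) -> set_approx e (wjoin K s) (wjoin K s').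
Proof.
move=> cC C2 KC s_le0 si0 s'_le0 s'i1 ss'.
have near f i : approx u e (f i + s i *: (u : E)) (f i + s' i *: (u : E)).
  have := ss' i; rewrite ler_norml => /andP[ge le].
  by split; rewrite -addrA -scalerDl; apply: le_addu; lra.
split=> [z [f Kf zf]|z [f Kf zf]].
  have [z' _ zf'] := weighted_lub cC C2 (fun i => KC _ _ (Kf i)) s'_le0 s'i1.
  by exists z'; [exists f|exact: approx_lub zf zf' _].
have [z' _ zf'] := weighted_lub cC C2 (fun i => KC _ _ (Kf i)) s_le0 si0.
by exists z'; [exists f|exact: approx_lub zf' zf _].
Qed.

(** Terms with weight at most [- D] lie below every point of [C], hence below
    the term of weight zero: they do not contribute to the supremum. *)
Lemma approx_lub_near C f g s i0 D e c d :
  0 < D -> (forall x y, C x -> C y -> x + (- D) *: (u : E) <= y) ->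
  0 <= e -> (forall i, C (f i)) -> (forall i, C (g i)) -> s i0 = 0 ->
  (forall i, - D < s i -> approx u e (f i) (g i)) ->
  lub_of (fun i => f i + s i *: (u : E)) c ->
  lub_of (fun i => g i + s i *: (u : E)) d -> approx u e c d.
Proof.
move=> D0 CD e0 Cf Cg si0 near fc gd.
have half h k z w : (forall i, C (h i)) -> (forall i, C (k i)) ->
    (forall i, - D < s i -> h i <= k i + e *: (u : E)) ->
    lub_of (fun i => h i + s i *: (u : E)) z ->
    lub_of (fun i => k i + s i *: (u : E)) w -> z <= w + e *: (u : E).
  move=> Ch Ck hk hz kw; have kw' i : k i + s i *: (u : E) <= w by apply/kw: i.
  apply/hz => i; have [si|] := ltP (- D) (s i).
    apply: le_trans (riesz_leD2r _ _ _ (hk i si)) _.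
    by rewrite addrAC; apply: riesz_leD2r.
  move=> /(le_addu u (h i))/le_trans; apply.
  apply: le_trans (CD _ _ (Ch i) (Ck i0)) _; apply: le_trans (addu_ge u w e0).
  by have := kw' i0; rewrite si0 scale0r addr0.
split; [apply: (half f g)|apply: (half g f)] => // i /near; first by case.
by case.
Qed.

(** Relevant members of the family are close to [K0], so a choice of points in
    them can be exchanged for a choice of points in [K0], whose supremum stays
    in [K0] by convexity; conversely a point of [K0] is the supremum of the
    constant choice. *)
Lemma wjoin_near C (K0 : set E) K s i0 D e : compact (C : set (hu_space u)) ->
  mp_convex (u : E) C -> (forall i, K i `<=` C) -> (forall i, K i !=set0) ->
  compact (K0 : set (hu_space u)) -> mp_convex (u : E) K0 -> K0 `<=` C ->
  0 < D -> (forall x y, C x -> C y -> x + (- D) *: (u : E) <= y) ->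
  0 <= e -> (forall i, s i <= 0) -> s i0 = 0 ->
  (forall i, - D < s i -> set_approx e K0 (K i)) ->
  set_approx e K0 (wjoin K s).
Proof.
move=> cC C2 KC Kn0 cK0 K02 K0C D0 CD e0 s_le0 si0 near.
split=> [k K0k|z [f Kf zf]].
  have /choice[f Kf] i : exists y, K i y /\ (- D < s i -> approx u e k y).
    have [/near[/(_ _ K0k)[y Ky ky] _]|_] := boolP (- D < s i); first by exists y.
    by have [y Ky] := Kn0 i; exists y.
  have CfK i : C (f i) by apply: KC (Kf i).1.
  have [z _ zf] := weighted_lub cC C2 CfK s_le0 si0.
  exists z; first by exists f => // i; case: (Kf i).
  apply: (@approx_lub_near C (fun=> k) f s i0 D) zf => // [_|i|b].
  - exact: K0C.
  - exact: (Kf i).2.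
  - split=> [kb i|/(_ i0)]; last by rewrite si0 scale0r addr0.
    exact: le_trans (addu_le u k (s_le0 i)) kb.
have /choice[g K0g] i : exists y, K0 y /\ (- D < s i -> approx u e y (f i)).
  have [/near[_ /(_ _ (Kf i))[y K0y yf]]|_] := boolP (- D < s i); first by exists y.
  have [|_ /(_ _ (Kf i0))[y K0y _]] := near i0; last by exists y.
  by rewrite si0 oppr_lt0.
have [c K0c cg] := weighted_lub cK0 K02 (fun i => (K0g i).1) s_le0 si0.
exists c => //; apply: approx_lub_near D0 CD e0 _ _ si0 _ cg zf => i.
- by apply: K0C; case: (K0g i).
- exact: KC (Kf i).
- by case: (K0g i).
Qed.

End weighted_join.

(** * Hausdorff distance *)

Section hausdorff.
Context {R : realType} {M : metricType R}.
Implicit Types (K L : hyperspace M) (x y : M) (e : R).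

Lemma hyperspaceP K : (val K : set M) !=set0 /\ compact (val K : set M).
Proof. exact: (set_valP K). Qed.

Lemma hausdorff_le K L e :
  (forall x, val K x -> exists2 y, val L y & mdist x y <= e) ->
  (forall y, val L y -> exists2 x, val K x & mdist y x <= e) ->
  mdist K L <= e.
Proof.
have half (A B : hyperspace M) :
    (forall x, val A x -> exists2 y, val B y & mdist x y <= e) ->
    excess (val A) (val B) <= e.
  move=> AB; apply: ge_sup; first by have [[a Aa] _] := hyperspaceP A; exists (pt_dist a (val B)), a.
  move=> _ [x Ax <-]; have [y By xy] := AB _ Ax; apply: le_trans xy.
  by apply: ge_inf; [exists 0 => _ [z _ <-]; exact: mdist_ge0|exists y].
by move=> KL LK; rewrite (_ : mdist K L = hausdorff_dist K L)// /hausdorff_dist ge_max !half.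
Qed.

Lemma compact_mdist_bounded (A : set M) y : compact A ->
  exists b : R, forall x, A x -> mdist x y <= b.
Proof.
move=> /compact_near_coveringP cA.
have : \forall t \near +oo, A `<=` [set x | mdist x y <= t].
  apply: cA => x _.
  exists ([set z | mdist x z < 1], [set t | mdist x y + 1 <= t]).
    split; last exact: nbhs_pinfty_ge (num_real _).
    by apply/metricType_numDomainType.nbhs_mdistP; exists 1 => /=.
  move=> [z t] /= [xz xyt]; apply: le_trans (metric_triangle z x y) _.
  by rewrite metric_sym addrC; apply: le_trans xyt; rewrite lerD2l ltW.
by move=> /filter_ex[b Ab]; exists b.
Qed.

Lemma hausdorff_lt K L e x : mdist K L < e -> val K x ->
  exists2 y, val L y & mdist x y < e.
Proof.
rewrite (_ : mdist K L = hausdorff_dist K L)// /hausdorff_dist gt_max.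
move=> /andP[KLe _] Kx.
have [L0 _] := hyperspaceP L; have [_ cK] := hyperspaceP K.
have ptle z y : val L y -> pt_dist z (val L) <= mdist z y.
  by move=> Ly; apply: ge_inf; [exists 0 => _ [w _ <-]; exact: mdist_ge0|exists y].
have : pt_dist x (val L) < e.
  apply: le_lt_trans KLe; apply: ub_le_sup; last by exists x.
  have [y Ly] := L0; have [b Kb] := compact_mdist_bounded y cK.
  by exists b => _ [z Kz <-]; apply: le_trans (ptle z y Ly) (Kb _ Kz).
case/inf_lt => [|_ [y Ly <-] xye]; last by exists y.
by have [y Ly] := L0; exists (mdist x y), y.
Qed.

End hausdorff.

Section set_approximation.
Context {R : realType} {E : archiRieszType R} (u : order_unit E).
Implicit Types (A B C : set E) (K L : hyperspace (hu_space u)) (e : R).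

Lemma set_approx_sym e A B : set_approx u e A B -> set_approx u e B A.
Proof.
by move=> [AB BA]; split=> x => [/BA|/AB] [y Ay /approx_sym xy]; exists y.
Qed.

Lemma set_approx_trans e1 e2 B A C : set_approx u e1 A B ->
  set_approx u e2 B C -> set_approx u (e1 + e2) A C.
Proof.
have half (X Y Z : set E) a b :
    (forall x, X x -> exists2 y, Y y & approx u a x y) ->
    (forall x, Y x -> exists2 y, Z y & approx u b x y) ->
    forall x, X x -> exists2 y, Z y & approx u (a + b) x y.
  move=> XY YZ x /XY[y /YZ[z Zz yz] xy]; exists z => //; exact: approx_trans xy yz.
move=> /[dup] /set_approx_sym[BA _] [AB _] /[dup] /set_approx_sym[CB _] [BC _].
split=> x; first exact: half AB BC x.
move=> Cx; have [y Ay xy] := half _ _ _ _ _ CB BA x Cx.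
by exists y => //; rewrite addrC; exact: approx_sym.
Qed.

Lemma set_approx_closure e A : 0 < e ->
  set_approx u e A (closure (A : set (hu_space u))).
Proof.
move=> e0; split=> [x Ax|x /closure_approx/(_ e e0)[y Ay xy]].
  by exists x; [exact: subset_closure|exact/approxxx/ltW].
by exists y => //; exact: approx_sym.
Qed.

Lemma set_approx_mdist e K L : 0 <= e -> set_approx u e (val K) (val L) ->
  mdist K L <= e + e.
Proof.
move=> e0 [KL LK]; apply: hausdorff_le => x.
  by move=> /KL[y Ly xy]; exists y => //; exact: approx_Dhu.
by move=> /LK[y Ky xy]; exists y => //; apply: approx_Dhu => //; exact: approx_sym.
Qed.

Lemma mdist_set_approx e K L : mdist K L < e -> set_approx u e (val K) (val L).
Proof.
move=> KL; split=> x Kx.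
  by have [y Ly xy] := hausdorff_lt KL Kx; exists y => //; exact: Dhu_lt_approx.
rewrite metric_sym in KL; have [y Ly xy] := hausdorff_lt KL Kx; exists y => //.
by apply: approx_sym; exact: Dhu_lt_approx.
Qed.

(** Max-plus combinations of two points are nonexpansive. *)
Lemma closure_mp_convex A : mp_convex (u : E) A ->
  mp_convex (u : E) (closure (A : set (hu_space u)) : set E).
Proof.
move=> /mp_convexP A2; apply/mp_convexP => x y t t0 /closure_approx clx.
move=> /closure_approx cly; apply/closure_approx => e e0.
have [[x' Ax xx'] [y' Ay yy']] := (clx _ e0, cly _ e0).
exists (rjoin (x' : E) ((y' : E) + t *: (u : E))); first exact: A2.
exact: approx_rjoin.
Qed.

End set_approximation.

(** * Weights from distances *)

Section weights.
Context {R : realType} (I : Type).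
Implicit Types (p q : I -> R) (D e : R) (i : I).

Definition gap p : R := inf (range p).

(** For distances [p i] from a point to the members of a family, the weight is
    zero within twice the infimal distance, a nonempty range even if the infimum
    is not attained, and falls to [- D] at three times that distance. *)
Definition weight D p i : R := - (D * Num.max 0 (p i / gap p - 2)).

Lemma gap_le p i : (forall j, 0 <= p j) -> gap p <= p i.
Proof. by move=> p0; apply: ge_inf; [exists 0 => _ [j _ <-]|exists i]. Qed.

Lemma le_gap p i0 e : (forall i, e <= p i) -> e <= gap p.
Proof. by move=> pe; apply: lb_le_inf; [exists (p i0), i0|move=> _ [i _ <-]]. Qed.

Lemma weight_le0 D p i : 0 <= D -> weight D p i <= 0.
Proof. by move=> D0; rewrite oppr_le0 mulr_ge0// le_max lexx. Qed.

Lemma weight_eq0 D p i0 : 0 < gap p -> exists i, weight D p i = 0.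
Proof.
move=> p0; have : gap p < 2 * gap p by lra.
case/inf_lt => [|_ [i _ <-] pi]; first by exists (p i0), i0.
exists i; rewrite /weight max_l ?mulr0 ?oppr0// subr_le0 ler_pdivrMr//.
exact: ltW.
Qed.

Lemma weight_gt D p i : 0 < D -> 0 < gap p -> - D < weight D p i ->
  p i < 3 * gap p.
Proof.
move=> D0 p0; rewrite ltrN2 gtr_pMr// gt_max ltr01/= ltrBlDr ltr_pdivrMr//.
Qed.

Lemma gap_lipschitz p q e i0 : (forall i, 0 <= p i) -> (forall i, 0 <= q i) ->
  (forall i, `|p i - q i| <= e) -> `|gap p - gap q| <= e.
Proof.
move=> p0 q0 pq; rewrite ler_distlC; apply/andP; split.
  apply: (le_gap i0) => i.
  by have := pq i; have := gap_le i p0; rewrite ler_norml; lra.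
rewrite -lerBlDr; apply: (le_gap i0) => i.
by have := pq i; have := gap_le i q0; rewrite ler_norml; lra.
Qed.

(** The bound does not depend on [i] because the distances are at most 1: the
    ratio of an unbounded distance to the gap would vary without control. *)
Lemma weight_lipschitz D p q e i : 0 <= D -> 0 < gap p ->
  (forall i, 0 <= p i <= 1) -> (forall i, 0 <= q i <= 1) ->
  (forall i, `|p i - q i| <= e) -> e <= gap p / 2 ->
  `|weight D p i - weight D q i| <= D * (4 * e / gap p ^+ 2).
Proof.
move=> D0 gp0 p01 q01 pq ep.
have p0 j : 0 <= p j by case/andP: (p01 j).
have q0 j : 0 <= q j by case/andP: (q01 j).
have gpq := gap_lipschitz i p0 q0 pq.
have e0 : 0 <= e := le_trans (normr_ge0 _) (pq i).
have gq_ge : gap p / 2 <= gap q by move: gpq; rewrite ler_norml; lra.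
have gq0 : 0 < gap q by lra.
have gq1 : gap q <= 1 by apply: le_trans (gap_le i q0) _; case/andP: (q01 i).
have max_lip (a b c : R) : `|Num.max c a - Num.max c b| <= `|a - b|.
  by case: (leP c a); case: (leP c b); rewrite ler_norml; case: (ler0P (a - b)); lra.
rewrite /weight -opprD normrN -mulrBr normrM ger0_norm// ler_wpM2l//.
apply: le_trans (max_lip _ _ _) _.
have -> : p i / gap p - 2 - (q i / gap q - 2) =
    ((p i - q i) * gap q + q i * (gap q - gap p)) / (gap p * gap q).
  by field; rewrite !gt_eqF.
rewrite normrM normfV [`|gap p * _|]gtr0_norm ?mulr_gt0//.
rewrite ler_pdivrMr ?mulr_gt0//.
apply: (@le_trans _ _ (e + e)).
  apply: le_trans (ler_normD _ _) _; rewrite !normrM.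
  rewrite (gtr0_norm gq0) (ger0_norm (q0 i)) [`|gap q - _|]distrC.
  apply: lerD; first by rewrite -[e]mulr1 ler_pM// ltW.
  by rewrite -[e]mul1r ler_pM//; case/andP: (q01 i).
have -> : 4 * e / gap p ^+ 2 * (gap p * gap q) = 4 * e * gap q / gap p.
  by field; rewrite gt_eqF.
by rewrite ler_pdivlMr//; nra.
Qed.

End weights.

(** * The space of compact max-plus convex sets *)

Section mpcc.
Context {R : realType} {E : archiRieszType R} (u : order_unit E) (C : set E).
Hypothesis C_neq0 : C !=set0.
Hypothesis C_compact : compact (C : set (hu_space u)).
Hypothesis C_convex : mp_convex (u : E) C.

Implicit Types K L : MPCC u C.

Definition carrier K : set E := val (val K).

Definition mpcc_dist K L : R := mdist (val K) (val L).

Lemma carrier_sub K : carrier K `<=` C.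
Proof. by have [] := set_valP K. Qed.

Lemma carrier_convex K : mp_convex (u : E) (carrier K).
Proof. by have [] := set_valP K. Qed.

Lemma carrier_neq0 K : carrier K !=set0.
Proof. by have [] := hyperspaceP (val K). Qed.

Lemma carrier_compact K : compact (carrier K : set (hu_space u)).
Proof. by have [] := hyperspaceP (val K). Qed.

Lemma mpcc_exists (A : set E) : A !=set0 ->
  compact (A : set (hu_space u)) -> mp_convex (u : E) A -> A `<=` C ->
  exists K, carrier K = A.
Proof.
move=> A0 cA A2 AC.
pose H : hyperspace (hu_space u) := exist _ (A : set (hu_space u)) (mem_set (conj A0 cA)).
have HC : MPCC u C H by [].
by exists (exist _ H (mem_set HC)).
Qed.

Lemma nbhs_mpcc K (U : set (MPCC u C)) :
  nbhs K U <-> exists2 e, 0 < e & forall L, mpcc_dist K L < e -> U L.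
Proof.
by rewrite -nbhs_ballE; split=> -[e /= e0 eU]; exists e.
Qed.

Lemma mpcc_metrizable : metrizable R (MPCC u C).
Proof.
exists mpcc_dist; split=> [K|K L|K L|K L N|K].
- exact: mdistxx.
- by move=> /mdist_positivity/val_inj.
- exact: metric_sym.
- exact: metric_triangle.
- by apply/seteqP; split=> U /nbhs_mpcc.
Qed.

Lemma mpcc_dist_approx K L e : mpcc_dist K L < e ->
  set_approx u e (carrier K) (carrier L).
Proof. exact: mdist_set_approx. Qed.

Lemma approx_mpcc_dist K L e : 0 <= e ->
  set_approx u e (carrier K) (carrier L) -> mpcc_dist K L <= e + e.
Proof. exact: set_approx_mdist. Qed.

Definition mpcc_join (s : MPCC u C -> R) : set (hu_space u) :=
  closure (wjoin u carrier s : set (hu_space u)).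

Lemma mpcc_join_sub s K0 : (forall K, s K <= 0) -> s K0 = 0 ->
  mpcc_join s `<=` C.
Proof.
move=> s_le0 sK0; have clC := compact_closed (@metric_hausdorff _ _) C_compact.
rewrite ((closure_id _).1 clC); apply: closureS.
exact: wjoin_sub C_compact C_convex carrier_sub s_le0 sK0.
Qed.

Lemma mpcc_join_exists s K0 : (forall K, s K <= 0) -> s K0 = 0 ->
  exists L, carrier L = mpcc_join s.
Proof.
move=> s_le0 sK0; apply: mpcc_exists.
- have [z zj] := wjoin_neq0 C_compact C_convex carrier_sub carrier_neq0 s_le0 sK0.
  by exists z; exact: subset_closure.
- apply: subclosed_compact C_compact _; first exact: closed_closure.
  exact: mpcc_join_sub s_le0 sK0.
- by apply: closure_mp_convex; apply: wjoin_convex; exact: carrier_convex.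
exact: mpcc_join_sub s_le0 sK0.
Qed.

Section extension.
Variables (Y : topologicalType) (i : MPCC u C -> Y) (d : Y -> Y -> R).
Hypothesis d_xx : forall x, d x x = 0.
Hypothesis d_sym : forall x y, d x y = d y x.
Hypothesis d_triangle : forall x y z, d x z <= d x y + d y z.
Hypothesis d_nbhs :
  forall x, nbhs x = nbhs_ball_ (fun y e => [set z | d y z < e]) x.
Hypothesis i_emb : closed_embedding i.

Let d_ge0 x y : 0 <= d x y.
Proof. by have := d_triangle x y x; rewrite d_xx [d y x]d_sym; lra. Qed.

(* Truncation at 1 keeps the weights equicontinuous. *)
Let p y K := Num.min 1 (d y (i K)).

Let p01 y K : 0 <= p y K <= 1.
Proof. by rewrite /p le_min ler01 d_ge0 ge_min lexx. Qed.

Let p0 y K : 0 <= p y K. Proof. by case/andP: (p01 y K). Qed.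

Let p_lip y z K : `|p y K - p z K| <= d y z.
Proof.
have := d_triangle y z (i K); have := d_triangle z y (i K); have := d_ge0 y z.
rewrite [d z y]d_sym ler_norml /p.
by case: (leP 1 (d y (i K))); case: (leP 1 (d z (i K))); lra.
Qed.

Let K_C : exists K, carrier K = C.
Proof. exact: mpcc_exists. Qed.

Let nbhs_not_range y : ~ range i y ->
  nbhs_ball_ (fun y e => [set z | d y z < e]) y (~` range i).
Proof.
have [_ cl _] := i_emb => Ny; rewrite -d_nbhs.
by apply: open_nbhs_nbhs; split=> //; exact: closed_openC.
Qed.

Let gap_gt0 y : ~ range i y -> 0 < gap (p y).
Proof.
move=> /nbhs_not_range[e /= e0 eN]; have [K0 _] := K_C.
apply: (@lt_le_trans _ _ (Num.min 1 e)); first by rewrite lt_min ltr01.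
apply: (le_gap K0) => K; rewrite /p le_min ge_min lexx/=.
rewrite ge_min; apply/orP; right; rewrite leNgt; apply/negP => /eN; apply.
by exists K.
Qed.

(** The values of [r] off the range of [i] are the weighted joins of all the
    members of the space, weighted by their distance to the given point. *)
Lemma mpcc_extension : exists2 r : Y -> MPCC u C, continuous r & cancel i r.
Proof.
have [i_inj _ i_open] := i_emb.
have [D D0 CD] := compact_spread C_compact.
pose s y := weight D (p y).
have s_le0 y K : s y K <= 0 by apply: weight_le0; exact: ltW.
have [KC _] := K_C.
have s_eq0 y : ~ range i y -> exists K, s y K = 0.
  by move=> /gap_gt0; exact: weight_eq0.
have /choice[r rP] y : exists L, (forall K, i K = y -> L = K) /\
    (~ range i y -> carrier L = mpcc_join (s y)).
  have [[K _ <-]|Ny] := pselect (range i y).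
    by exists K; split=> [K' /i_inj //|[]]; exists K.
  have [K0 sK0] := s_eq0 y Ny.
  have [L LE] := mpcc_join_exists (s_le0 y) sK0.
  by exists L; split=> // K iK; exfalso; apply: Ny; exists K.
exists r => [y0 U /nbhs_mpcc[e e0 eU]|K]; last exact: (rP _).1.
suff [n n0 yn] : exists2 n, 0 < n & forall y, d y0 y < n -> mpcc_dist (r y0) (r y) < e.
  rewrite nbhs_simpl/= d_nbhs; exists n => //= y /yn; exact: eU.
(* Off the range of i, two closures and a change of weights cost 3 * (e / 7) in
   the order, hence 6 * (e / 7) in the Hausdorff distance. *)
have e7 : 0 < e / 7 by lra.
have [[K0 _ K0y]|Ny0] := pselect (range i y0).
  have -> : r y0 = K0 by apply: (rP y0).1.
  have [n n0 nK] : exists2 n, 0 < n & forall K, d y0 (i K) < n -> mpcc_dist K0 K < e / 7.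
    have : nbhs K0 [set K | mpcc_dist K0 K < e / 7].
      by apply/nbhs_mpcc; exists (e / 7).
    rewrite nbhsE => -[V [/i_open[W oW <-] WK0] WV].
    have : nbhs y0 W by apply: open_nbhs_nbhs; split=> //; rewrite -K0y.
    rewrite d_nbhs => -[n /= n0 nW]; exists n => // K y0K; apply: WV; exact: nW.
  (* If gap < m / 4, a relevant K has distance below 3 * m / 4 <= 3 / 4 from y,
     so the truncation is inactive and K has distance below m from K0. *)
  pose m := Num.min 1 n.
  have m0 : 0 < m by rewrite lt_min ltr01.
  have [m1 mn] : m <= 1 /\ m <= n by rewrite !ge_min !lexx orbT.
  exists (m / 4); first by rewrite divr_gt0.
  move=> y y0y; have [[K _ Ky]|Ny] := pselect (range i y).
    have -> : r y = K by apply: (rP y).1.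
    by apply: lt_trans (_ : e / 7 < e); [apply: nK; rewrite Ky; lra|lra].
  have g0 := gap_gt0 Ny; have [K1 sK1] := s_eq0 y Ny.
  have gm : gap (p y) < m / 4.
    apply: le_lt_trans (gap_le K0 (p0 y)) _; apply: le_lt_trans (_ : d y y0 < _).
      by rewrite /p K0y ge_min lexx orbT.
    by rewrite d_sym.
  have near K : - D < s y K -> set_approx u (e / 7) (carrier K0) (carrier K).
    move=> /(weight_gt D0 g0); rewrite /p gt_min => pK.
    apply: mpcc_dist_approx; apply: nK; have := d_triangle y0 y (i K).
    by case/orP: pK => pK; lra.
  have := wjoin_near C_compact C_convex carrier_sub carrier_neq0
    (@carrier_compact K0) (@carrier_convex K0) (@carrier_sub K0) D0 CD (ltW e7)
    (s_le0 y) sK1 near.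
  move=> /set_approx_trans/(_ (set_approx_closure u _ e7)).
  rewrite -[closure _]/(mpcc_join _) -(rP y).2// => /approx_mpcc_dist.
  by move=> /(_ ltac:(lra)) /le_lt_trans; apply; lra.
have g0 := gap_gt0 Ny0; have [K0 sK0] := s_eq0 y0 Ny0.
have [n n0 nN] : exists2 n, 0 < n & forall y, d y0 y < n -> ~ range i y.
  have [n /= n0 nN] := nbhs_not_range Ny0.
  by exists n.
(* The last bound turns the Lipschitz estimate for the weights into e / 7. *)
pose g := gap (p y0).
pose m := Num.min n (Num.min (g / 2) (e / 7 * g ^+ 2 / (4 * D))).
have m0 : 0 < m.
  by rewrite !lt_min n0 !divr_gt0// ?mulr_gt0// exprn_gt0.
exists m => // y; rewrite !lt_min => /and3P[/nN Ny yg ye].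
have [K1 sK1] := s_eq0 y Ny.
have ss K : `|s y0 K - s y K| <= e / 7.
  apply: le_trans (weight_lipschitz K (ltW D0) g0 (p01 y0) (p01 y) (p_lip y0 y) (ltW yg)) _.
  rewrite mulrA ler_pdivrMr ?exprn_gt0//.
  by move: ye; rewrite ltr_pdivlMr ?mulr_gt0//; lra.
have := wjoin_weights C_compact C_convex carrier_sub (s_le0 y0) sK0 (s_le0 y) sK1 ss.
move=> /set_approx_trans/(_ (set_approx_closure u _ e7)).
move=> /(set_approx_trans (set_approx_sym (set_approx_closure u _ e7))).
rewrite -![closure _]/(mpcc_join _) -(rP y).2// -(rP y0).2// => /approx_mpcc_dist.
by move=> /(_ ltac:(lra)) /le_lt_trans; apply; lra.
Qed.
End extension.
End mpcc.

Theorem corollary5 (R : realType) (E : archiRieszType R)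
  (E_neq0 : exists x : E, x != 0) (u : order_unit E) (C : set E)
  (C_neq0 : C !=set0) (C_compact : compact (C : set (hu_space u)))
  (C_convex : mp_convex u C) :
  absolute_retract R (MPCC u C).
Proof.
split=> [|Y i [d [d_xx d0 d_sym d_tri d_nbhs]] i_emb]; first exact: mpcc_metrizable.
exact: mpcc_extension d_xx d_sym d_tri d_nbhs i_emb.
Qed.
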